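(* Let $m\ge 1$ be an integer, let $a>0$, and let $F_m$ be a real polynomial of degree $m$ with $F_m(0)=1$ all of whose zeros are real. Let $\alpha_1,\ldots,\alpha_m$ denote the zeros of the polynomial $t\mapsto F_m(-t)$, multiple zeros being repeated according to multiplicity. For an integer $p$ consider the condition $$(\ast_p)\qquad 0\le \alpha_1\le\alpha_2\le\cdots\le\alpha_p\quad\text{and}\quad \big(\{a,a+1,a+2,\ldots\}\cap[a,\alpha_p)\big)\subset\{\alpha_1,\alpha_2,\ldots,\alpha_p\}.$$ (i) If $(\ast_p)$ holds for $p=m$, then all zeros of the polynomial $\hat{w}(a;F_m\,|\,x)$ are real and negative. (ii) If $(\ast_p)$ holds for $p=m-1$ and $\alpha_m$ is any real number, then all zeros of $\hat{w}(a;F_m\,|\,x)$ are real and at most one of them is positive.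
   Context: $(a)_n=a(a+1)\cdots(a+n-1)$, $(a)_0=1$, is the Pochhammer symbol. For real $a$ and a polynomial $F_m$ of degree $m$ with $F_m(0)=1$, the $F_m$-Eulerian polynomial $\hat{w}(x)=\hat{w}(a;F_m\,|\,x)$ is the polynomial in $x$ of degree at most $m$ defined by $$\sum_{n=0}^{\infty}F_m(n)\frac{(a)_n}{n!}x^n=\frac{\hat{w}(a;F_m\,|\,x)}{(1-x)^{m+a}},$$ where $(1-x)^{-(m+a)}$ is understood as its power series at $0$ (equivalently, as the principal branch for $|x|<1$). For $p=0$ (i.e. $m=1$ in part (ii)) the condition $(\ast_p)$ is vacuous. *)

(* Defs.v *)
From HB Require Import structures.
From mathcomp Require Export all_boot all_order all_algebra.
From mathcomp Require Export complex.
From mathcomp Require Export all_classical all_reals all_analysis.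
Export Order.TTheory GRing.Theory Num.Theory numFieldNormedType.Exports.

Set Implicit Arguments.
Unset Strict Implicit.
Unset Printing Implicit Defensive.

Local Open Scope classical_set_scope.
Local Open Scope ring_scope.

Definition pochhammer (R : realType) (a : R) (n : nat) : R :=
  \prod_(i < n) (a + i%:R).

(* The base 1 - x of the real power is positive for |x| < 1; two polynomials
   that agree on this interval are equal, so at most one w satisfies this. *)
Definition is_eulerian_poly (R : realType) (m : nat) (a : R) (F w : {poly R})
    : Prop :=
  (size w <= m.+1)%N /\
  forall x : R, `|x| < 1 ->
    pseries (fun n => F.[n%:R] * (pochhammer a n / n`!%:R)) x @ \oo
      --> w.[x] / (1 - x) `^ (m%:R + a).

(* The zeros are the complex ones; in particular this is false for p = 0. *)
Definition all_zeros_real (R : realType) (p : {poly R}) : Prop :=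
  forall z : R[i], root (map_poly (real_complex R) p) z -> z \is Num.real.

(* For p != 0: s lists the zeros of p, each repeated according to its
   multiplicity, and there are no other zeros, even complex ones. *)
Definition zero_list (R : realType) (p : {poly R}) (s : seq R) : Prop :=
  p = lead_coef p *: \prod_(z <- s) ('X - z%:P).

(* The condition on alpha_1, ..., alpha_p, where alpha_i is the entry of index
   i - 1 of the sequence alpha; path asserts 0 <= alpha_1 <= ... <= alpha_p. *)
Definition star_cond (R : realType) (a : R) (alpha : seq R) (p : nat) : Prop :=
  (0 < p)%N ->
    path <=%R 0 (take p alpha) /\
    [set a + k%:R | k in [set: nat]] `&` `[a, alpha`_p.-1[
      `<=` [set` take p alpha].

(* Main.v *)
From mathcomp Require Import ring lra zify polyrcf.
Require Import Defs.
Set Implicit Arguments.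
Unset Strict Implicit.
Unset Printing Implicit Defensive.
Local Open Scope classical_set_scope.
Local Open Scope ring_scope.

(** Since F(0) = 1, F(n) is the product of the factors 1 + n / al over the zeros
    al of F(-t). Such a factor acts on power series as 1 + (x d/dx) / al, hence
    on numerators over powers of 1 - x as the first order operator [eulerian_op]
    (divided by al). Starting from the binomial series of (1 - x)^(-a)
    ([binom_series]), w is obtained from 1 by applying these operators in any
    order ([eulerian_rec], [eulerian_polyE]).

    Since (1 + n / a) (a)_n = (a + 1)_n, if a is among the al, it can be dropped
    and a replaced by a + 1 without changing w ([eulerian_rec_rcons]). The
    condition on the zeros ensures that this can be repeated until no zero
    exceeds the parameter ([neg_split_eulerian_star]). Then the operators
    preserve the property of having only simple negative zeros
    ([neg_split_eulerian_op]): for such a p, a numerator over (1 - x)^c, the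
    image x(1 - x)p' + (al + (c - al)x)p alternates in sign along the zeros of p
    and 0, and also at minus infinity unless al + deg p = c, in which case the
    degree does not grow. This gives (i).

    For (ii), the unrestricted zero is applied last. If it is positive, there
    are still zeros between the points given by the zeros of p and 0; if it is
    negative, there are zeros between those given by minus infinity and the
    zeros of p. In both cases there are deg p distinct negative zeros and the
    degree is at most deg p + 1, so at most one further zero remains, which is
    real. *)

(** * The operator on numerators *)

(** For c = m + a, the operator taking the numerator over (1 - x)^c of a power
    series f to al times the numerator over (1 - x)^(c + 1) of f + x f' / al. *)
Definition eulerian_op (R : realType) (al c : R) (p : {poly R}) : {poly R} :=
  'X * (1 - 'X) * p^`() + (al%:P + (c - al)%:P * 'X) * p.

(** The Eulerian polynomial for the parameter a and the product of the factors
    1 + n / al over al in s, built one factor at a time; the last entry of s is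
    applied first. *)
Fixpoint eulerian_rec (R : realType) (a : R) (s : seq R) : {poly R} :=
  if s is al :: s' then
    al^-1%:P * eulerian_op al ((size s')%:R + a) (eulerian_rec a s')
  else 1.

(** The operators 1 + (x d/dx) / al commute. *)
Lemma eulerian_opC (R : realType) (al be c : R) (p : {poly R}) :
  eulerian_op al (c + 1) (eulerian_op be c p) =
  eulerian_op be (c + 1) (eulerian_op al c p).
Proof.
rewrite /eulerian_op !poly.derivE !polyCB !polyCD; ring.
Qed.

Lemma eulerian_opZ (R : realType) (al c k : R) (p : {poly R}) :
  eulerian_op al c (k%:P * p) = k%:P * eulerian_op al c p.
Proof. rewrite /eulerian_op !poly.derivE; ring. Qed.

(** Numerator form of a (a + 1)_n = (a + n) (a)_n: passing from a to a + 1 is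
    applying the factor 1 + n / a. *)
Lemma eulerian_rec_shift (R : realType) (a : R) (s : seq R) :
  a%:P * eulerian_rec (a + 1) s =
  eulerian_op a ((size s)%:R + a) (eulerian_rec a s).
Proof.
elim: s => [|al s IH] /=.
  by rewrite /eulerian_op poly.derivE add0r subrr polyC0; ring.
have -> : (size s)%:R + (a + 1) = (size s)%:R + a + 1 by ring.
rewrite -[(size s).+1]addn1 natrD.
have -> : (size s)%:R + 1 + a = (size s)%:R + a + 1 by ring.
by rewrite eulerian_opZ eulerian_opC -IH eulerian_opZ; ring.
Qed.

(** Numerator form of (1 + n / a) (a)_n = (a + 1)_n: an entry a that is applied
    first can be removed at the price of replacing the parameter by a + 1. *)
Lemma eulerian_rec_rcons (R : realType) (a : R) (s : seq R) : a != 0 ->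
  eulerian_rec a (rcons s a) = eulerian_rec (a + 1) s.
Proof.
move=> a0; elim: s => [|al s IH] /=; last first.
  rewrite IH size_rcons -[(size s).+1]addn1 natrD.
  by have -> : (size s)%:R + 1 + a = (size s)%:R + (a + 1) by ring.
rewrite /eulerian_op poly.derivE add0r subrr polyC0 mulr0 mul0r add0r addr0 mulr1.
by rewrite -polyCM mulVf.
Qed.

(** * The binomial series *)

(** The coefficient (a)_n / n! of x^n in (1 - x)^(-a). *)
Definition binom_coef (R : realType) (a : R) (n : nat) : R :=
  pochhammer a n / n`!%:R.

Lemma pochhammerS (R : realType) (a : R) n :
  pochhammer a n.+1 = pochhammer a n * (a + n%:R).
Proof. by rewrite /pochhammer big_ord_recr. Qed.

Lemma pochhammer_shift (R : realType) (a : R) n :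
  a * pochhammer (a + 1) n = pochhammer a n * (a + n%:R).
Proof.
rewrite -pochhammerS /pochhammer big_ord_recl addr0; congr (_ * _).
by apply: eq_bigr => i _; rewrite -addrA -natr1 [1 + _]addrC.
Qed.

Lemma binom_coef0 (R : realType) (a : R) : binom_coef a 0 = 1.
Proof. by rewrite /binom_coef /pochhammer big_ord0 divr1. Qed.

Lemma binom_coef_ge0 (R : realType) (a : R) n : 0 <= a -> 0 <= binom_coef a n.
Proof.
by move=> a0; rewrite divr_ge0 ?ler0n// prodr_ge0// => i _; rewrite addr_ge0.
Qed.

Lemma fact_neq0 (R : realType) n : (n`!%:R : R) != 0.
Proof. by rewrite pnatr_eq0 -lt0n fact_gt0. Qed.

Lemma binom_coefS (R : realType) (a : R) n :
  n.+1%:R * binom_coef a n.+1 = (a + n%:R) * binom_coef a n.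
Proof.
have f0 := fact_neq0 R n.
have n0 : (n.+1%:R : R) != 0 by rewrite pnatr_eq0.
rewrite /binom_coef pochhammerS factS natrM.
by move: (n.+1%:R) n0 => k n0; field; rewrite n0 f0.
Qed.

Lemma binom_coef_shift (R : realType) (a : R) n :
  a * binom_coef (a + 1) n = (a + n%:R) * binom_coef a n.
Proof.
by rewrite /binom_coef mulrA pochhammer_shift mulrAC mulrC.
Qed.

Lemma pseries_diffs_binom (R : realType) (a : R) :
  pseries_diffs (binom_coef a) = (fun n => a * binom_coef (a + 1) n).
Proof.
by apply/funext => n; rewrite /pseries_diffs binom_coefS binom_coef_shift.
Qed.

Lemma binom_coef_pascal (R : realType) (a : R) n :
  binom_coef (a + 1) n.+1 = binom_coef (a + 1) n + binom_coef a n.+1.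
Proof.
have n0 : (n.+1%:R : R) != 0 by rewrite pnatr_eq0.
apply: (mulfI n0); rewrite mulrDr !binom_coefS -(binom_coef_shift a n) -natr1.
by ring.
Qed.

Lemma pseries0 (R : realType) (c : nat -> R) (x : R) : pseries c x 0 = 0.
Proof. by rewrite /pseries /series /= big_geq. Qed.

Lemma pseriesS (R : realType) (c : nat -> R) (x : R) n :
  pseries c x n.+1 = pseries c x n + c n * x ^+ n.
Proof. by rewrite /pseries /series /= big_nat_recr. Qed.

(** Multiplication of a partial sum by 1 - x telescopes, by the Pascal rule. *)
Lemma sum_binom_coef (R : realType) (a x : R) n :
  (1 - x) * pseries (binom_coef (a + 1)) x n.+1 =
  pseries (binom_coef a) x n.+1 - binom_coef (a + 1) n * x ^+ n * x.
Proof.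
elim: n => [|n IH]; first by rewrite !pseriesS !pseries0 !binom_coef0; ring.
rewrite pseriesS mulrDr [in RHS]pseriesS IH binom_coef_pascal !exprS; ring.
Qed.

(** The partial sums for a + 1 are at most those for a divided by 1 - x. *)
Lemma binom_series_ub (R : realType) (x : R) N n (a : R) :
  0 <= x -> x < 1 -> 0 <= a -> a <= N%:R ->
  pseries (binom_coef a) x n <= (1 - x)^-1 ^+ N.
Proof.
move=> x0 x1.
have x1' : 0 < 1 - x by rewrite subr_gt0.
(* each coefficient is nondecreasing in a *)
have mono (b c : R) k : 0 <= b -> b <= c -> binom_coef b k <= binom_coef c k.
  move=> b0 bc; rewrite ler_pM2r ?invr_gt0 ?ltr0n ?fact_gt0//.
  by apply: ler_prod => i _; rewrite addr_ge0 ?lerD2r.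
have monoS (b c : R) : 0 <= b -> b <= c ->
    pseries (binom_coef b) x n <= pseries (binom_coef c) x n.
  move=> b0 bc; rewrite /pseries /series /=; apply: ler_sum => i _.
  by rewrite ler_wpM2r ?exprn_ge0// mono.
move=> a0 aN; apply: (le_trans (monoS _ _ a0 aN)) => {a a0 aN}.
elim: N {monoS mono} => [|N IH].
  rewrite expr0; case: n => [|n]; first by rewrite pseries0.
  rewrite /pseries /series /=.
  rewrite big_nat_recl// big1 ?addr0 ?binom_coef0 ?mulr1// => i _.
  by rewrite /binom_coef /pochhammer big_ord_recl addr0 !mul0r.
rewrite -addn1 natrD addn1 exprS ler_pdivlMl//.
case: n IH => [|n] IH.
  by rewrite pseries0 mulr0 exprn_ge0// invr_ge0 ltW.
rewrite sum_binom_coef; apply: le_trans IH.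
by rewrite gerBl -mulrA mulr_ge0 ?binom_coef_ge0 ?addr_ge0 ?mulr_ge0 ?exprn_ge0.
Qed.

Lemma is_cvg_binom_series (R : realType) (a x : R) :
  0 <= a -> `|x| < 1 -> cvgn (pseries (binom_coef a) x).
Proof.
move=> a0 x1; apply: normed_cvg.
rewrite (_ : [normed _] = pseries (binom_coef a) `|x|); last first.
  apply/funext => n; rewrite /normed_series_of /pseries /series /=.
  by apply: eq_bigr => i _; rewrite normrM normrX ger0_norm ?binom_coef_ge0.
apply: nondecreasing_is_cvgn.
  apply/nondecreasing_seqP => n.
  by rewrite pseriesS lerDl mulr_ge0 ?exprn_ge0 ?binom_coef_ge0.
exists ((1 - `|x|)^-1 ^+ (Num.bound a)) => _ [n _ <-].
by apply: binom_series_ub => //; exact: ltW (archi_boundP a0).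
Qed.

Lemma binom_series_shift (R : realType) (a x : R) : 0 <= a -> `|x| < 1 ->
  (1 - x) * limn (pseries (binom_coef (a + 1)) x) =
  limn (pseries (binom_coef a) x).
Proof.
move=> a0 x1.
have c0 := is_cvg_binom_series a0 x1.
have c1 : cvgn (pseries (binom_coef (a + 1)) x).
  by apply: is_cvg_binom_series => //; rewrite addr_ge0.
have l1 : (fun n => (1 - x) * pseries (binom_coef (a + 1)) x n.+1) @ \oo
    --> (1 - x) * limn (pseries (binom_coef (a + 1)) x).
  by apply: cvgM; [exact: cvg_cst|rewrite cvg_shiftS].
have l2 : (fun n => (1 - x) * pseries (binom_coef (a + 1)) x n.+1) @ \oo
    --> limn (pseries (binom_coef a) x) - 0 * x.
  under eq_fun do rewrite sum_binom_coef.
  apply: cvgB; first by rewrite cvg_shiftS.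
  by apply: cvgM; [exact: (cvg_series_cvg_0 c1)|exact: cvg_cst].
by rewrite -(cvg_lim _ l1)// (cvg_lim _ l2)// mul0r subr0.
Qed.

Lemma is_derive_binom_series (R : realType) (a x : R) : 0 <= a -> `|x| < 1 ->
  is_derive x 1 (fun y => limn (pseries (binom_coef a) y))
    (a * limn (pseries (binom_coef (a + 1)) x)).
Proof.
move=> a0 x1.
have cv (k b y : R) : 0 <= b -> `|y| < 1 ->
    pseries (fun n => k * binom_coef b n) y @ \oo
      --> k * limn (pseries (binom_coef b) y).
  move=> b0 y1; rewrite (_ : pseries _ _ = fun n => k * pseries (binom_coef b) y n).
    by apply: cvgM; [exact: cvg_cst|exact: is_cvg_binom_series].
  apply/funext => n; rewrite /pseries /series /= mulr_sumr.
  by apply: eq_bigr => i _; rewrite mulrA.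
(* the midpoint of |x| and 1 lies inside the disc of convergence *)
have K0 : 0 <= (`|x| + 1) / 2 by rewrite divr_ge0// addr_ge0.
have K1 : `|(`|x| + 1) / 2| < 1 by rewrite (ger0_norm K0); lra.
have a1 : 0 <= a + 1 by rewrite addr_ge0.
have a2 : 0 <= a + 1 + 1 by rewrite addr_ge0.
rewrite -(cvg_lim _ (cv a _ _ a1 x1))// -pseries_diffs_binom.
apply: (@pseries_snd_diffs _ _ ((`|x| + 1) / 2)).
- exact: is_cvg_binom_series.
- by rewrite pseries_diffs_binom; apply/cvg_ex; eexists; exact: cv.
- rewrite pseries_diffs_binom (_ : pseries_diffs _ =
      (fun n => a * (a + 1) * binom_coef (a + 1 + 1) n)).
    by apply/cvg_ex; eexists; exact: cv.
  apply/funext => n; have := pseries_diffs_binom (a + 1).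
  move/(congr1 (fun f => f n)); rewrite /pseries_diffs => e.
  by rewrite mulrCA e mulrA.
- by rewrite (ger0_norm K0); lra.
Qed.

(** Both sides solve (1 - x) f' = a f with value 1 at 0, so the product of the
    series with (1 - x)^a has derivative 0. *)
Lemma binom_series (R : realType) (a x : R) : 0 < a -> `|x| < 1 ->
  pseries (binom_coef a) x @ \oo --> ((1 - x) `^ a)^-1.
Proof.
move=> a_gt0 x1; have a0 := ltW a_gt0.
have pos (y : R) : `|y| < 1 -> 0 < 1 - y by rewrite ltr_norml subr_gt0 => /andP[].
pose f (y : R) := limn (pseries (binom_coef a) y) * (1 - y) `^ a.
have df (y : R) : `|y| < 1 -> is_derive y 1 f 0.
  move=> y1.
  have d1 := is_derive_binom_series a0 y1.
  have y1' := pos _ y1.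
  have d2 : is_derive y 1 (fun z : R => (1 - z) `^ a)
      (- (a * (1 - y) `^ (a - 1))).
    have d3 : is_derive y 1 (fun z : R => 1 - z) (-1).
      have h := is_deriveB (is_derive_cst (1 : R) y (1 : R))
        (is_derive_id y (1 : R)).
      by apply: (is_derive_eq h); rewrite sub0r.
    have := @is_derive1_comp R (fun z : R => z `^ a) (fun z : R => 1 - z)
      y _ _ (is_derive1_powR a y1') d3.
    by rewrite /= mulrN1.
  have h := is_deriveM d1 d2; apply: (is_derive_eq h).
  rewrite -(binom_series_shift a0 y1) /GRing.scale /=.
  by rewrite -(mulr_powRB1 (ltW y1') a_gt0); ring.
have : f x = f 0.
  have ball (y : R) : (y \in `[x, 0]) || (y \in `[0, x]) -> `|y| < 1.
    by move: x1; rewrite !in_itv /= !ltr_norml; lra.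
  have cf (i : interval R) :
      (forall y, y \in i -> (y \in `[x, 0]) || (y \in `[0, x])) ->
      {within [set` i], continuous f}.
    by move=> h; apply: derivable_within_continuous => y /h /ball /df [].
  have sub (u v y : R) : y \in `]u, v[ -> y \in `[u, v].
    exact: subset_itv_oo_cc.
  have [x0|x0] := leP x 0.
    have [y||c _] := @MVT_segment R f (fun=> 0) x 0 x0.
    - by move=> /sub yi; apply/df/ball; rewrite yi.
    - by apply: cf => y ->.
    - by rewrite mul0r => /eqP; rewrite subr_eq0 => /eqP.
  have [y||c _] := @MVT_segment R f (fun=> 0) 0 x (ltW x0).
  - by move=> /sub yi; apply/df/ball; rewrite yi orbT.
  - by apply: cf => y ->; rewrite orbT.
  - by rewrite mul0r => /eqP; rewrite subr_eq0 => /eqP.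
have -> : f 0 = 1.
  rewrite /f subr0 powR1 mulr1; apply/cvg_lim => //.
  rewrite -cvg_shiftS (_ : (fun _ => _) = fun=> 1); first exact: cvg_cst.
  apply/funext => n; rewrite /pseries /series /=.
  rewrite big_nat_recl// big1 ?addr0 ?binom_coef0 ?mulr1//.
  by move=> i _; rewrite expr0n /= mulr0.
rewrite /f => /(canRL (mulfK _)); rewrite mul1r => <-.
  exact: is_cvg_binom_series.
by rewrite gt_eqF// powR_gt0// pos.
Qed.

(** * The generating function and uniqueness *)

(** The generating function identity behind the recurrence, by induction on s
    for all a at once. *)
Lemma eulerian_rec_series (R : realType) (s : seq R) (a x : R) :
  0 < a -> 0 \notin s -> `|x| < 1 ->
  pseries (fun n => \prod_(al <- s) (1 + n%:R / al) * binom_coef a n) x @ \oo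
    --> (eulerian_rec a s).[x] / (1 - x) `^ ((size s)%:R + a).
Proof.
move=> a0 s0 x1; elim: s a a0 s0 => [|al s IH] a a0.
  move=> _ /=; rewrite hornerC mul1r add0r.
  under [X in pseries X]eq_fun do rewrite big_nil mul1r.
  exact: binom_series.
rewrite in_cons negb_or eq_sym => /andP[al0 s0].
have x1' : 0 < 1 - x by move: x1; rewrite ltr_norml subr_gt0 => /andP[].
have a1 : 0 < a + 1 by rewrite addr_gt0.
pose t b n := \prod_(al <- s) (1 + n%:R / al) * binom_coef b n.
(* 1 + n / al = (1 - a / al) + (a + n) / al, and (a + n) (a)_n = a (a + 1)_n *)
have -> :
  pseries (fun n => \prod_(al <- al :: s) (1 + n%:R / al) * binom_coef a n) x
    = fun n => (1 - a / al) * pseries (t a) x n +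
      (a / al) * pseries (t (a + 1)) x n.
  apply/funext => n; rewrite /pseries /series /= !mulr_sumr -big_split.
  apply: eq_bigr => i _; rewrite /t big_cons.
  set P := \prod_(j <- s) _; have -> : a / al *
      (P * binom_coef (a + 1) i * x ^+ i) =
      al^-1 * P * (a * binom_coef (a + 1) i) * x ^+ i by ring.
  by rewrite binom_coef_shift /=; field.
have -> : (eulerian_rec a (al :: s)).[x] / (1 - x) `^ ((size (al :: s))%:R + a) =
    (1 - a / al) * ((eulerian_rec a s).[x] / (1 - x) `^ ((size s)%:R + a)) +
    (a / al) * ((eulerian_rec (a + 1) s).[x] /
      (1 - x) `^ ((size s)%:R + (a + 1))).
  have -> : (size (al :: s))%:R + a = (size s)%:R + a + 1
    by rewrite /= -natr1; ring.
  have -> : (size s)%:R + (a + 1) = (size s)%:R + a + 1 by ring.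
  rewrite powRD; last by rewrite (gt_eqF x1') implybT.
  rewrite powRr1; last exact: ltW.
  have /(congr1 (fun p => p.[x])) := eulerian_rec_shift a s.
  rewrite hornerCM /= hornerCM /eulerian_op !hornerE.
  set W1 := (eulerian_rec (a + 1) s).[x] => e.
  have -> : W1 = a^-1 * (a * W1) by rewrite mulKf ?gt_eqF.
  rewrite e.
  have p0 : (1 - x) `^ ((size s)%:R + a) != 0 by rewrite gt_eqF ?powR_gt0.
  have := lt0r_neq0 a0; have := lt0r_neq0 x1'.
  move: ((1 - x) `^ _) p0 => p p0 ? ? /=. by field; apply/and4P.
by apply: cvgD; (apply: cvgM; first exact: cvg_cst); exact: IH.
Qed.

Lemma poly_eq_unit_ball (R : realType) (p q : {poly R}) :
  (forall x : R, `|x| < 1 -> p.[x] = q.[x]) -> p = q.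
Proof.
move=> pq; apply/eqP; rewrite -subr_eq0; apply/eqP.
apply: (@roots_geq_poly_eq0 _ _ [seq i.+2%:R^-1 | i <- iota 0 (size (p - q))]).
- apply/allP => _ /mapP[i _ ->]; rewrite rootE !hornerE pq ?subrr//.
  by rewrite ger0_norm ?invr_ge0 ?ler0n// invf_lt1 ?ltr1n ?ltr0n.
- rewrite map_inj_uniq ?iota_uniq// => i j /invr_inj /eqP.
  by rewrite eqr_nat => /eqP[].
- by rewrite size_map size_iota.
Qed.

Lemma eulerian_polyE (R : realType) (m : nat) (a : R) (s : seq R)
    (F w : {poly R}) :
  0 < a -> 0 \notin s -> size s = m ->
  (forall x, F.[x] = \prod_(al <- s) (1 + x / al)) ->
  is_eulerian_poly m a F w -> w = eulerian_rec a s.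
Proof.
move=> a0 s0 sm FE [_ wE]; apply: poly_eq_unit_ball => x x1.
have x1' : 0 < 1 - x by move: x1; rewrite ltr_norml subr_gt0 => /andP[].
have := wE _ x1; under [X in pseries X]eq_fun do rewrite FE.
have := eulerian_rec_series a0 s0 x1; rewrite sm => h1 h2.
have /(mulIf _) : w.[x] / (1 - x) `^ (m%:R + a) =
    (eulerian_rec a s).[x] / (1 - x) `^ (m%:R + a) by exact: (cvg_unique _ h2 h1).
by apply; rewrite invr_eq0 gt_eqF ?powR_gt0.
Qed.

(** Since F(0) = 1, the zeros al of F(-t) are nonzero and F is the product of
    the factors 1 + t / al. *)
Lemma zero_list_prod (R : realType) (F : {poly R}) (s : seq R) : F.[0] = 1 ->
  zero_list (F \Po (- 'X)) s ->
  0 \notin s /\ forall x, F.[x] = \prod_(al <- s) (1 + x / al).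
Proof.
move=> F0 FE.
have Fx x : F.[x] = lead_coef (F \Po (- 'X)) * \prod_(al <- s) (- x - al).
  have -> : F.[x] = (F \Po (- 'X)).[- x] by rewrite horner_comp !hornerE opprK.
  by rewrite {1}FE hornerZ horner_prod; under eq_bigr do rewrite hornerXsubC.
have := Fx 0; rewrite F0 => e.
have s0 : 0 \notin s.
  apply/negP => s0; move: e; rewrite (big_rem _ s0) /= oppr0 addr0 mul0r mulr0.
  by move/eqP; rewrite oner_eq0.
split=> // x; rewrite Fx.
have -> : \prod_(al <- s) (- x - al) =
    \prod_(al <- s) (- 0 - al) * \prod_(al <- s) (1 + x / al).
  rewrite -big_split /=; apply: eq_big_seq => al als.
  have al0 : al != 0 by apply: contraNneq s0 => <-.
  by field.
by rewrite mulrA -e mul1r.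
Qed.

(** * Coefficients and values of the operator *)

Lemma eulerian_op_coef (R : realType) (al c : R) (p : {poly R}) d :
  (size p <= d.+1)%N ->
  (eulerian_op al c p)`_d.+1 = (c - al - d%:R) * p`_d.
Proof.
move=> sp; rewrite /eulerian_op.
have -> : 'X * (1 - 'X) * p^`() + (al%:P + (c - al)%:P * 'X) * p
  = 'X * (p^`() - 'X * p^`()) + al%:P * p + (c - al)%:P * ('X * p) by ring.
rewrite !(coefD, coefCM, coefXM, coefN) /= !coef_deriv (nth_default 0 sp).
rewrite mul0rn mulr0.
case: d sp => [|d] sp; first by rewrite /=; ring.
by rewrite /= -mulr_natl; ring.
Qed.

Lemma size_eulerian_op (R : realType) (al c : R) (p : {poly R}) :
  (size (eulerian_op al c p) <= (size p).+1)%N.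
Proof.
apply/leq_sizeP => -[|j]; first by rewrite ltn0.
rewrite ltnS => pj.
by rewrite eulerian_op_coef ?leqW// nth_default// mulr0.
Qed.

Lemma eulerian_op_at0 (R : realType) (al c : R) (p : {poly R}) :
  (eulerian_op al c p).[0] = al * p.[0].
Proof. by rewrite /eulerian_op !hornerE; ring. Qed.

Lemma eulerian_op_root (R : realType) (al c x : R) (p : {poly R}) :
  root p x -> (eulerian_op al c p).[x] = x * (1 - x) * p^`().[x].
Proof. by move=> /rootP px; rewrite /eulerian_op !hornerE px; ring. Qed.

(** * Zeros from alternating signs *)

(** A polynomial whose signs alternate along an increasing list has a zero
    strictly between any two consecutive entries. *)
Lemma alternating_roots (R : rcfType) (q : {poly R}) (e x : R) (l : seq R) :
  path <%R x l ->
  (forall i, (i <= size l)%N -> 0 < e * (-1) ^+ i * q.[nth 0 (x :: l) i]) ->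
  exists s, [/\ size s = size l, path <%R x s,
    all (fun z => z < last x l) s & all (root q) s].
Proof.
elim: l e x => [|y l IH] e x; first by exists [::].
move=> /= /andP[xy yl] alt.
have [i il|s [ss ys sl sr]] := IH (- e) y yl.
  rewrite (_ : - e * (-1) ^+ i = e * (-1) ^+ i.+1); first exact: alt i.+1 il.
  by rewrite exprS; ring.
have ex := alt 0%N isT; have ey := alt 1%N isT.
rewrite /= expr0 expr1 ?mulr1 in ex ey.
have [|z zxy zr] := @poly_ivtoo R q x y (ltW xy).
  rewrite -oppr_gt0.
  have : 0 < (e * q.[x]) * (e * -1 * q.[y]) by exact: mulr_gt0.
  have -> : e * q.[x] * (e * -1 * q.[y]) = e ^+ 2 * - (q.[x] * q.[y]) by ring.
  rewrite pmulr_rgt0// lt0r sqr_ge0 sqrf_eq0 andbT.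
  by apply: contraTneq ex => ->; rewrite mul0r ltxx.
move: zxy; rewrite in_itv /= => /andP[xz zy].
exists (z :: s); split => /=.
- by rewrite ss.
- rewrite xz /=; case: s ys {ss sl sr} => //= u s /andP[yu ->].
  by rewrite (lt_trans zy yu).
- rewrite sl andbT; apply: (lt_le_trans zy).
  have := yl; rewrite lt_path_sortedE => /andP[/allP h _].
  by case: (l) h => //= u l' /(_ (last u l') (mem_last _ _))/ltW.
- by rewrite zr.
Qed.

(** At the i-th of the simple zeros of a product in increasing order, the
    derivative has the sign given by the number of larger zeros. *)
Lemma deriv_prod_root_sign (R : realType) (rs : seq R) i :
  sorted <%R rs -> (i < size rs)%N ->
  0 < (-1) ^+ (size rs - i.+1) * (\prod_(r <- rs) ('X - r%:P))^`().[nth 0 rs i].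
Proof.
elim: rs i => [//|r rs IH] i; rewrite lt_sorted_pairwise /= => /andP[rmin].
rewrite -lt_sorted_pairwise => rss irs.
rewrite big_cons poly.derivE derivXsubC mul1r !hornerE.
case: i irs => [_|i] /=.
  rewrite subrr mul0r addr0 subSS subn0 horner_prod.
  elim: (rs) rmin => [|y l IHl] /=; first by rewrite big_nil mulr1 ltr01.
  move=> /andP[ry /IHl h]; rewrite big_cons exprS mulN1r hornerXsubC.
  rewrite (_ : _ * _ = (y - r) *
    ((-1) ^+ size l * \prod_(j <- l) ('X - j%:P).[r])); last by ring.
  by rewrite mulr_gt0// subr_gt0.
rewrite ltnS subSS => irs.
have rt : root (\prod_(r <- rs) ('X - r%:P)) rs`_i.
  by rewrite root_prod_XsubC mem_nth.
rewrite (rootP rt) add0r mulrCA mulr_gt0 ?IH// subr_gt0.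
by apply: (allP rmin); exact: mem_nth.
Qed.

(** * Preservation of simple negative zeros *)

(** p splits over R with simple negative zeros, listed in increasing order by
    rs, and has a positive leading coefficient. *)
Definition neg_split (R : realType) (p : {poly R}) (rs : seq R) : Prop :=
  [/\ sorted <%R rs, all (fun r => r < 0) rs, 0 < lead_coef p & zero_list p rs].

Lemma horner_prod_root0_gt0 (R : realType) (rs : seq R) :
  all (fun r => r < 0) rs -> 0 < (\prod_(r <- rs) ('X - r%:P)).[0].
Proof.
move=> /allP neg; rewrite horner_prod big_seq prodr_gt0// => r /neg.
by rewrite hornerXsubC sub0r oppr_gt0.
Qed.

Lemma neg_split_at0 (R : realType) (p : {poly R}) (rs : seq R) :
  neg_split p rs -> 0 < p.[0].
Proof.
by move=> [_ neg k0 ->]; rewrite hornerZ mulr_gt0// horner_prod_root0_gt0.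
Qed.

Lemma neg_split_size (R : realType) (p : {poly R}) (rs : seq R) :
  neg_split p rs -> size p = (size rs).+1.
Proof.
by move=> [_ _ k0 ->]; rewrite size_scale ?gt_eqF// size_prod_XsubC.
Qed.

Lemma neg_split_root (R : realType) (p : {poly R}) (rs : seq R) x :
  neg_split p rs -> root p x = (x \in rs).
Proof.
by move=> [_ _ k0 ->]; rewrite rootZ ?gt_eqF// root_prod_XsubC.
Qed.

Lemma neg_splitI (R : realType) (p : {poly R}) (rs : seq R) :
  sorted <%R rs -> all (fun r => r < 0) rs -> all (root p) rs ->
  (size p <= (size rs).+1)%N -> 0 < p.[0] -> neg_split p rs.
Proof.
move=> srt neg rt sz p0.
have u : uniq rs by exact: lt_sorted_uniq.
have pn0 : p != 0 by apply: contraTneq p0 => ->; rewrite horner0 ltxx.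
have szE : size p = (size rs).+1.
  by apply/eqP; rewrite eqn_leq sz max_poly_roots.
have E : zero_list p rs by apply: all_roots_prod_XsubC; rewrite ?uniq_rootsE.
split=> //; move: p0; rewrite E hornerZ pmulr_lgt0 ?horner_prod_root0_gt0//.
by rewrite -E.
Qed.

Lemma neg_splitZ (R : realType) (p : {poly R}) (rs : seq R) k : 0 < k ->
  neg_split p rs -> neg_split (k%:P * p) rs.
Proof.
move=> k0 pr; have [srt neg _ _] := pr.
apply: neg_splitI => //.
- by apply/allP => r; rewrite mul_polyC rootZ ?gt_eqF// (neg_split_root _ pr).
- by rewrite mul_polyC size_scale ?gt_eqF// (neg_split_size pr).
- by rewrite hornerCM mulr_gt0// (neg_split_at0 pr).
Qed.

(** The sign near minus infinity; 0 < q`_n makes n the degree of q. *)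
Lemma sign_minfty (R : realType) (q : {poly R}) n (b : R) :
  (size q <= n.+1)%N -> 0 < q`_n -> exists2 M, M < b & 0 < (-1) ^+ n * q.[M].
Proof.
move=> sq qn.
have szq : size q = n.+1.
  apply/eqP; rewrite eqn_leq sq ltnNge; apply/negP => h.
  by move: qn; rewrite nth_default ?ltxx.
have lq : lead_coef q = q`_n by rewrite lead_coefE szq.
pose r := (-1) ^+ n *: (q \Po (- 'X)).
have lr : lead_coef r = q`_n.
  rewrite lead_coefZ lead_coef_comp ?size_polyN ?size_polyX// lq szq /=.
  by rewrite lead_coefN lead_coefX mulrCA -expr2 sqrr_sign mulr1.
have [|N hN] := @poly_pinfty_gt_lc R r; first by rewrite lr.
exists (Num.min (- N) (b - 1)); first by rewrite gt_min; apply/orP; right; lra.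
set M := Num.min _ _.
have : N <= - M by rewrite lerNr ge_min lexx.
move=> /hN; rewrite lr /r hornerZ horner_comp !hornerE opprK.
exact: lt_le_trans.
Qed.

(** At a negative zero r of p the operator takes the value r (1 - r) p'(r), so
    its sign is opposite to that of p'(r), and alternates along the zeros. *)
Lemma eulerian_op_sign (R : realType) (al c : R) (p : {poly R})
    (rs : seq R) i :
  neg_split p rs -> (i < size rs)%N ->
  0 < (-1) ^+ size rs * (-1) ^+ i * (eulerian_op al c p).[rs`_i].
Proof.
move=> pr irs; have [srt neg k0 E] := pr.
have ri : rs`_i \in rs by rewrite mem_nth.
have r0 : rs`_i < 0 by exact: (allP neg).
rewrite eulerian_op_root ?(neg_split_root _ pr)// E derivZ hornerZ.
have := deriv_prod_root_sign srt irs.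
set D := _.[_] => D0.
have sg : (-1) ^+ size rs = (-1) ^+ (size rs - i.+1) * (-1) ^+ i * -1 :> R.
  by rewrite -!exprD -exprSr; congr (_ ^+ _); lia.
have si : (-1) ^+ i * (-1) ^+ i = 1 :> R by rewrite -expr2 sqrr_sign.
have -> : (-1) ^+ size rs * (-1) ^+ i * (rs`_i * (1 - rs`_i) * (lead_coef p * D))
    = (-1) ^+ i * (-1) ^+ i * (- rs`_i * (1 - rs`_i) *
      (lead_coef p * ((-1) ^+ (size rs - i.+1) * D))) by rewrite sg; ring.
rewrite si mul1r; apply: mulr_gt0; apply: mulr_gt0 => //; first by rewrite oppr_gt0.
by rewrite subr_gt0 (lt_trans r0).
Qed.

Lemma path_rcons_neg (R : realType) (x : R) (l : seq R) :
  x < 0 -> all (fun r => r < 0) l -> path <%R x l -> path <%R x (rcons l 0).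
Proof.
move=> x0 /allP l0 xl; rewrite rcons_path xl /=.
by have := mem_last x l; rewrite in_cons => /predU1P[->//|/l0].
Qed.

Lemma nth_rcons_default (T : Type) (x0 : T) (s : seq T) i :
  nth x0 (rcons s x0) i = nth x0 s i.
Proof.
by rewrite nth_rcons; case: ltnP => h //; rewrite nth_default// if_same.
Qed.

(** The alternation continues at the point 0, where the operator takes the
    value al p(0). *)
Lemma eulerian_op_sign0 (R : realType) (al c : R) (p : {poly R})
    (rs : seq R) i :
  neg_split p rs -> 0 < al -> (i <= size rs)%N ->
  0 < (-1) ^+ size rs * (-1) ^+ i * (eulerian_op al c p).[nth 0 (rcons rs 0) i].
Proof.
move=> pr al0; rewrite nth_rcons_default leq_eqVlt => /predU1P[->|].
  2: exact: eulerian_op_sign.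
rewrite nth_default// eulerian_op_at0 -expr2 sqrr_sign mul1r mulr_gt0//.
exact: neg_split_at0 pr.
Qed.

(** One zero between any two consecutive points among the zeros of p and 0. *)
Lemma eulerian_op_roots_between (R : realType) (al c : R) (p : {poly R})
    (rs : seq R) :
  neg_split p rs -> 0 < al ->
  exists s, [/\ size s = size rs, sorted <%R s, all (fun r => r < 0) s &
    all (root (eulerian_op al c p)) s].
Proof.
move=> pr al0; have sgn := eulerian_op_sign0 c pr al0.
have [srt neg _ _] := pr.
case: rs srt neg sgn {pr} => [|x l]; first by exists [::].
move=> /= xl /andP[x0 l0] sgn.
have pth : path <%R x (rcons l 0) by exact: path_rcons_neg.
have [i il|s [ss /path_sorted ys]] :=
    alternating_roots pth (q := eulerian_op al c p)
      (e := (-1) ^+ (size l).+1).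
  by apply: sgn; rewrite size_rcons in il.
by rewrite last_rcons => sl sr; exists s; rewrite ss size_rcons.
Qed.

(** If al + deg p < c, the degree goes up by one with positive leading
    coefficient, so the alternation also continues at some point far to the
    left. *)
Lemma eulerian_op_left (R : realType) (al c : R) (p : {poly R})
    (rs : seq R) :
  neg_split p rs -> al + (size rs)%:R < c ->
  exists M, [/\ M < 0, path <%R M rs &
    0 < (-1) ^+ (size rs).+1 * (eulerian_op al c p).[M]].
Proof.
move=> pr ac; have [srt neg k0 E] := pr.
have szp := neg_split_size pr.
have [||M Mb sM] := @sign_minfty R (eulerian_op al c p) (size rs).+1 (head 0 rs).
- by rewrite -szp size_eulerian_op.
- rewrite eulerian_op_coef ?szp// mulr_gt0; [by []|by lra|].
  by move: k0; rewrite lead_coefE szp.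
case: rs srt neg Mb {ac pr E szp} sM => [|x l] /= xl neg Mb sM.
  by exists M.
by case/andP: neg => x0 _; exists M; rewrite (lt_trans Mb) ?Mb.
Qed.

(** Whatever the sign of al, if al + deg p < c and p has zeros: one zero left of
    them, and one between any two consecutive ones. *)
Lemma eulerian_op_roots_left (R : realType) (al c : R) (p : {poly R})
    (rs : seq R) :
  neg_split p rs -> al + (size rs)%:R < c ->
  exists s, [/\ size s = size rs, sorted <%R s, all (fun r => r < 0) s &
    all (root (eulerian_op al c p)) s].
Proof.
move=> pr ac; have [srt neg _ _] := pr.
have [M [M0 Mrs sM]] := eulerian_op_left pr ac.
have [[_|i il]|s [ss /path_sorted ys sl sr]] :=
  alternating_roots Mrs (q := eulerian_op al c p)
    (e := (-1) ^+ (size rs).+1).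
- by rewrite /= mulr1.
- have := eulerian_op_sign al c pr il.
  by rewrite !exprS !mulN1r mulrNN.
- exists s; split=> //; apply: sub_all sl => z zl; apply: (lt_trans zl).
  by have := mem_last M rs; rewrite in_cons => /predU1P[->//|/(allP neg)].
Qed.

(** Zeros left of, between, and right of the zeros of p: a full set. *)
Lemma eulerian_op_roots_all (R : realType) (al c : R) (p : {poly R})
    (rs : seq R) :
  neg_split p rs -> 0 < al -> al + (size rs)%:R < c ->
  exists s, [/\ size s = (size rs).+1, sorted <%R s, all (fun r => r < 0) s &
    all (root (eulerian_op al c p)) s].
Proof.
move=> pr al0 ac; have [srt neg _ _] := pr.
have [M [M0 Mrs sM]] := eulerian_op_left pr ac.
have pth : path <%R M (rcons rs 0) by exact: path_rcons_neg.
have [[_|i il]|s [ss /path_sorted ys]] :=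
    alternating_roots pth (q := eulerian_op al c p)
      (e := (-1) ^+ (size rs).+1).
- by rewrite /= mulr1.
- rewrite size_rcons in il.
  have := eulerian_op_sign0 c pr al0 il.
  by rewrite !exprS !mulN1r mulrNN.
- by rewrite last_rcons => sl sr; exists s; rewrite ss size_rcons.
Qed.

(** If al + deg p = c, the top coefficient vanishes, and the zeros in between
    already exhaust the degree. *)
Lemma neg_split_eulerian_op (R : realType) (al c : R) (p : {poly R})
    (rs : seq R) :
  neg_split p rs -> 0 < al -> al + (size rs)%:R <= c ->
  exists2 s, (size s <= (size rs).+1)%N & neg_split (eulerian_op al c p) s.
Proof.
move=> pr al0 ac; have szp := neg_split_size pr.
have q0 : 0 < (eulerian_op al c p).[0].
  by rewrite eulerian_op_at0 mulr_gt0// (neg_split_at0 pr).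
have szq := size_eulerian_op al c p; rewrite szp in szq.
move: ac; rewrite le_eqVlt => /predU1P[ac|ac].
  have [s [ss srt neg sr]] := eulerian_op_roots_between c pr al0.
  exists s; first by rewrite ss.
  apply: neg_splitI => //; rewrite ss.
  apply/leq_sizeP => j; rewrite leq_eqVlt => /predU1P[<-|jn].
    by rewrite eulerian_op_coef ?szp// -ac; ring.
  by rewrite nth_default// (leq_trans szq).
have [s [ss srt neg sr]] := eulerian_op_roots_all pr al0 ac.
by exists s; [rewrite ss|apply: neg_splitI; rewrite ?ss].
Qed.

Lemma neg_split_eulerian_rec (R : realType) (a : R) (s : seq R) :
  all (fun al => 0 < al <= a) s ->
  exists2 rs, (size rs <= size s)%N & neg_split (eulerian_rec a s) rs.
Proof.
elim: s => [_|al s IH] /=.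
  exists [::] => //; apply: neg_splitI => //; first by rewrite size_poly1.
  by rewrite hornerC.
move=> /andP[/andP[al0 ala] /IH [rs rss pr]].
have [|t tr qt] := @neg_split_eulerian_op R al ((size s)%:R + a) _ _ pr al0.
  by rewrite addrC lerD// ler_nat.
exists t; first exact: leq_trans tr _.
by apply: neg_splitZ; rewrite ?invr_gt0.
Qed.

(** The chain condition allows a, a + 1, ... to be absorbed one by one into the
    parameter, until no entry exceeds it; the order t of the entries records
    these removals. *)
Lemma neg_split_eulerian_star (R : realType) (a : R) (s : seq R) :
  0 < a -> all (fun al => 0 < al) s ->
  (forall k z, z \in s -> a + k%:R < z -> a + k%:R \in s) ->
  exists t rs, [/\ perm_eq s t, (size rs <= size t)%N &
    neg_split (eulerian_rec a t) rs].
Proof.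
elim: {s}_.+1 {-2}s (ltnSn (size s)) a => // n IH s sn a a0 pos star.
have [le_a|/allPn[z zs]] := boolP (all (fun al => al <= a) s).
  have [|rs rss sp] := @neg_split_eulerian_rec R a s.
    by apply/allP => z zs; rewrite (allP pos)// (allP le_a).
  by exists s, rs.
rewrite -ltNge => az.
have as_ : a \in s by rewrite -(addr0 a); apply: (star 0%N z) => //; rewrite addr0.
have [||||t [rs [st rst sp]]] := IH (rem a s) _ (a + 1).
- rewrite size_rem//; case: s sn as_ {pos star zs} => //= ? s sn _; exact: sn.
- by rewrite addr_gt0.
- by apply/allP => y /mem_rem /(allP pos).
- move=> k y /mem_rem ys; rewrite -addrA [1 + _]addrC natr1 => /(star _ _ ys).
  rewrite (perm_mem (perm_to_rem as_)) in_cons => /predU1P[e|//].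
  have : k.+1%:R = 0 :> R by apply: (addrI a); rewrite addr0.
  by move/eqP; rewrite pnatr_eq0.
exists (rcons t a), rs; rewrite size_rcons leqW// eulerian_rec_rcons ?gt_eqF//.
split=> //; rewrite (perm_trans (perm_to_rem as_))// perm_sym perm_rcons.
by rewrite perm_cons perm_sym.
Qed.

(** * Polynomials with at most one zero not accounted for *)

(** All but at most one of the zeros are given as distinct real numbers; the
    remaining factor is then real of degree at most one. *)
Lemma all_zeros_real_roots (R : realType) (q : {poly R}) (s : seq R) :
  q != 0 -> uniq s -> all (root q) s -> (size q <= (size s).+2)%N ->
  all_zeros_real q.
Proof.
move=> q0 us rs sz.
have [|g qE] := uniq_roots_prod_XsubC rs; first by rewrite uniq_rootsE.
have g0 : g != 0 by apply: contraNneq q0 => g0; rewrite qE g0 mul0r.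
have szg : (size g <= 2)%N.
  move: sz; rewrite qE size_Mmonic ?monic_prod_XsubC// size_prod_XsubC addnS /=.
  by rewrite -addn2 addnC leq_add2l.
move=> z; rewrite qE rmorphM rootM /= => /orP[|]; last first.
  rewrite rmorph_prod /root horner_prod prodf_seq_eq0 => /hasP[r _ /=].
  rewrite rmorphB /= map_polyX map_polyC /= hornerXsubC subr_eq0 => /eqP ->.
  by apply/complex_realP; exists r.
have gE : g = (g`_1)%:P * 'X + (g`_0)%:P.
  apply/polyP => -[|[|i]]; rewrite coefD coefMX !coefC /= ?add0r ?addr0//.
  by rewrite nth_default ?mul0r ?addr0// (leq_trans szg).
rewrite gE rmorphD rmorphM /= map_polyX !map_polyC /= /root !hornerE.
have [g1|g1] := eqVneq g`_1 0.
  rewrite g1 rmorph0 mul0r add0r => /eqP /complexI g00.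
  by move: g0; rewrite gE g1 g00 mul0r add0r eqxx.
rewrite addr_eq0 => /eqP e; apply/complex_realP; exists (- g`_0 / g`_1).
have g1' : real_complex R g`_1 != 0 by rewrite fmorph_eq0.
by apply: (mulfI g1'); rewrite e rmorphM rmorphN fmorphV; field.
Qed.

Lemma count_pos_le1 (R : realType) (q : {poly R}) (s : seq R) :
  q != 0 -> uniq s -> all (root q) s -> (size q <= (size s).+2)%N ->
  all (fun r => r < 0) s ->
  forall t, zero_list q t -> (count (fun z : R => (0 < z)%R) t <= 1)%N.
Proof.
move=> q0 us rs sz neg t E.
have lq0 : lead_coef q != 0 by rewrite lead_coef_eq0.
have szt : size q = (size t).+1 by rewrite E size_scale// size_prod_XsubC.
have st : (size s <= count (predC (fun z : R => (0 < z)%R)) t)%N.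
  rewrite -size_filter; apply: uniq_leq_size => // r rs'.
  rewrite mem_filter /= -leNgt (ltW (allP neg _ rs')) /=.
  by have := allP rs _ rs'; rewrite E rootZ// root_prod_XsubC.
have := count_predC (fun z : R => (0 < z)%R) t; lia.
Qed.

(** * The condition on the zeros, and the theorem *)

(** The condition read on the list of the first p entries: they are positive,
    and a + k is one of them whenever it is smaller than one of them. *)
Lemma star_cond_take (R : realType) (a : R) (alpha : seq R) (p : nat) :
  (p <= size alpha)%N -> 0 \notin alpha -> star_cond a alpha p ->
  all (fun al => 0 < al) (take p alpha) /\
  (forall k z, z \in take p alpha -> a + k%:R < z -> a + k%:R \in take p alpha).
Proof.
case: p => [|p] pa a0 star; first by rewrite take0.
have [srt sub] := star isT.
split.
  apply/allP => z zs; rewrite lt_neqAle.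
  have -> : 0 <= z by exact: (allP (order_path_min le_trans srt)).
  rewrite andbT.
  by apply: contraNneq a0 => ->; exact: mem_take zs.
move=> k z zs akz; apply: (sub (a + k%:R)); split; first by exists k.
rewrite /= in_itv /= lerDl ler0n /=.
have szt : size (take p.+1 alpha) = p.+1 by rewrite size_takel.
case/(nthP 0): zs akz => i; rewrite szt => ip <- akz; apply: (lt_le_trans akz).
rewrite -(@nth_take p.+1 _ 0 p)//.
apply: (sorted_leq_nth le_trans le_refl 0 (path_sorted srt)) => //.
- by rewrite inE szt.
- by rewrite inE szt.
Qed.

Theorem theorem1 (R : realType) (m : nat) (a : R) (F : {poly R})
    (alpha : m.-tuple R) (w : {poly R}) :
  (1 <= m)%N -> 0 < a ->
  size F = m.+1 -> F.[0] = 1 -> all_zeros_real F ->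
  zero_list (F \Po (- 'X)) alpha ->
  is_eulerian_poly m a F w ->
  (star_cond a alpha m ->
     all_zeros_real w /\ (forall x : R, root w x -> x < 0)) /\
  (star_cond a alpha m.-1 ->
     all_zeros_real w /\
     (forall s : seq R, zero_list w s -> (count (fun z : R => (0 < z)%R) s <= 1)%N)).
Proof.
move=> m1 a0 _ F0 _ FE wE.
have [al0 Fx] := zero_list_prod F0 FE.
(* the list of zeros may be processed in any order *)
have wrec t : perm_eq alpha t -> w = eulerian_rec a t.
  move=> pt; apply: (eulerian_polyE a0 _ _ _ wE).
  - by rewrite -(perm_mem pt).
  - by rewrite -(perm_size pt) size_tuple.
  - by move=> x; rewrite Fx; apply: perm_big.
split=> star.
  have [|pos chain] := star_cond_take _ al0 star; first by rewrite size_tuple.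
  have [t [rs [pt _ wrs]]] := neg_split_eulerian_star a0 pos chain.
  move: pt; rewrite take_oversize ?size_tuple// => /wrec wt.
  rewrite -wt in wrs.
  have [srt /allP neg _ _] := wrs.
  split; last by move=> x; rewrite (neg_split_root _ wrs) => /neg.
  apply: (@all_zeros_real_roots _ _ rs).
  - by rewrite -size_poly_gt0 (neg_split_size wrs).
  - exact: lt_sorted_uniq.
  - by apply/allP => x; rewrite (neg_split_root _ wrs).
  - by rewrite (neg_split_size wrs).
have [|pos chain] := star_cond_take _ al0 star.
  by rewrite size_tuple leq_pred.
have [t [rs [pt rst prs]]] := neg_split_eulerian_star a0 pos chain.
set be := alpha`_m.-1.
have mm : (m.-1 < size alpha)%N by rewrite size_tuple prednK.
have wt : w = eulerian_rec a (be :: t).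
  apply: wrec; rewrite -[X in perm_eq X _](cat_take_drop m.-1).
  rewrite (drop_nth 0)// prednK// drop_oversize ?size_tuple//.
  by rewrite cats1 perm_rcons perm_cons.
have be0 : be != 0 by apply: contraNneq al0 => <-; rewrite mem_nth.
(* whatever the sign of be, as many negative zeros as there are in rs; at most
   one further zero is left by the degree *)
have [s [ss srt neg sr]] : exists s, [/\ size s = size rs, sorted <%R s,
    all (fun r => r < 0) s &
    all (root (eulerian_op be ((size t)%:R + a) (eulerian_rec a t))) s].
  have [b0|b0] := ltP 0 be; first exact: eulerian_op_roots_between prs b0.
  apply: eulerian_op_roots_left prs _.
  rewrite (le_lt_trans (y := (size rs)%:R))// ?gerDr//.
  by rewrite (le_lt_trans (y := (size t)%:R)) ?ler_nat// ltrDl.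
have w0 : w != 0.
  have p0 := neg_split_at0 prs.
  apply: contraTneq p0 => w0; have : w.[0] = 0 by rewrite w0 horner0.
  rewrite wt /= hornerCM eulerian_op_at0 mulKf// => ->.
  by rewrite ltxx.
have wroot : all (root w) s.
  by rewrite wt /= mul_polyC; apply: sub_all sr => x xr; rewrite rootZ ?invr_eq0.
have us : uniq s by exact: lt_sorted_uniq.
have szw : (size w <= (size s).+2)%N.
  rewrite wt /= mul_polyC size_scale ?invr_eq0// ss -(neg_split_size prs).
  exact: size_eulerian_op.
split; first exact: all_zeros_real_roots us wroot szw.
exact: count_pos_le1 us wroot szw neg.
Qed.
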